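(* Let $p\ge 1$ be an integer. For each $k\in\{2,3,\dots,\lfloor\frac{9p-1}{2}\rfloor\}$ such that $\frac{9p}{\gcd(9p,k)}=3s$ for some positive integer $s$, the circulant graph $C_{9p}(1,k)$ is Type I, i.e. its total chromatic number equals $5$.
   Context: For integers $n$ and $1\le d_1<d_2<\dots<d_l\le\lfloor n/2\rfloor$, the circulant graph $C_n(d_1,\dots,d_l)$ has vertex set $\{0,1,\dots,n-1\}$, with $x$ and $y$ adjacent iff $x\equiv y\pm d_i \pmod n$ for some $i$. A total coloring of a graph $G$ assigns colors to vertices and edges so that adjacent vertices receive different colors, edges sharing an endpoint receive different colors, and each edge receives a color different from its two endpoints. The total chromatic number $\chi''(G)$ is the minimum number of colors in a total coloring; always $\chi''(G)\ge\Delta(G)+1$. A graph is Type I if $\chi''(G)=\Delta(G)+1$. *)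

(* Defs.v *)
From HB Require Import structures.
From mathcomp Require Import all_boot.

Set Implicit Arguments.
Unset Strict Implicit.
Unset Printing Implicit Defensive.

Record sgraph := SGraph {
  vertex :> finType;
  adj : rel vertex;
  adj_sym : symmetric adj;
  adj_irrefl : irreflexive adj
}.

Definition edges (G : sgraph) : {set {set G}} :=
  [set [set u.1; u.2] | u : G * G & adj u.1 u.2].

Definition edge (G : sgraph) : finType := {f : {set G} | f \in edges G}.

Definition max_degree (G : sgraph) : nat := \max_(x : G) #|[set y | adj x y]|.

Definition total_coloring (G : sgraph) (q : nat)
    (cv : {ffun G -> 'I_q}) (ce : {ffun edge G -> 'I_q}) : bool :=
  [&& [forall x, forall y, adj x y ==> (cv x != cv y)],
      [forall f : edge G, forall g : edge G,
        (f != g) && (val f :&: val g != set0) ==> (ce f != ce g)] &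
      [forall f : edge G, forall x : G, (x \in val f) ==> (ce f != cv x)]].

Definition total_colorable (G : sgraph) (q : nat) : bool :=
  [exists cv : {ffun G -> 'I_q}, exists ce : {ffun edge G -> 'I_q},
     total_coloring cv ce].

Lemma ex_total_colorable (G : sgraph) : exists q, total_colorable G q.
Proof.
exists #|{: G + edge G}|.
apply/existsP; exists [ffun x => enum_rank (inl x : G + edge G)].
apply/existsP; exists [ffun f => enum_rank (inr f : G + edge G)].
apply/and3P; split; apply/forallP=> a; apply/forallP=> b; apply/implyP.
- move=> ab; rewrite !ffunE (inj_eq enum_rank_inj).
  by apply: contraTneq ab => -[->]; rewrite adj_irrefl.
- case/andP=> ab _; rewrite !ffunE (inj_eq enum_rank_inj).
  by apply: contraNneq ab => -[->].
- by move=> _; rewrite !ffunE (inj_eq enum_rank_inj).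
Qed.

Definition total_chromatic_number (G : sgraph) : nat :=
  ex_minn (ex_total_colorable G).

Definition type_I (G : sgraph) : Prop :=
  total_chromatic_number G = (max_degree G).+1.

(* [x = y - d] is written additively as [x + d = y], natural subtraction being
   truncated. The guard [x != y] is there only to get a loopless graph for
   every [D]; it is redundant when 1 <= d <= n./2 for d in D, see
   [circulant_adjE]. *)
Definition circulant_rel (n : nat) (D : seq nat) : rel 'I_n :=
  fun x y => (x != y) &&
    has (fun d => (x == y + d %[mod n]) || (x + d == y %[mod n])) D.

Lemma circulant_sym n D : symmetric (@circulant_rel n D).
Proof.
move=> x y; rewrite /circulant_rel eq_sym; congr (_ && _).
by apply: eq_has => d; rewrite orbC eq_sym [in X in _ || X]eq_sym.
Qed.

Lemma circulant_irrefl n D : irreflexive (@circulant_rel n D).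
Proof. by move=> x; rewrite /circulant_rel eqxx. Qed.

Definition circulant (n : nat) (D : seq nat) : sgraph :=
  SGraph (@circulant_sym n D) (@circulant_irrefl n D).

Lemma circulant_adjE n D (x y : circulant n D) :
    all (fun d => 1 <= d <= n./2) D ->
  adj x y = has (fun d => (x == y + d %[mod n]) || (x + d == y %[mod n])) D.
Proof.
move=> /allP D_bnd; rewrite /= /circulant_rel.
case: (x =P y) => //= <-; apply/esym/hasPn => d /D_bnd /andP[d_gt0 d_le].
have n_gt0 : 0 < n by apply: leq_ltn_trans (ltn_ord x).
have d_lt : d < n.
  by apply: leq_ltn_trans d_le _; rewrite -divn2 ltn_Pdiv.
rewrite [in X in _ || X]eq_sym orbb -[X in X == _ %[mod _]]addn0 eqn_modDl.
by rewrite mod0n modn_small // eq_sym -lt0n d_gt0.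
Qed.

(* Main.v *)
(** A total coloring that is invariant under translation by a divisor [N] of the
    number of vertices is a pattern on [Z/N]; whether such a pattern exists only
    depends on [k] modulo [N], up to sign.

    If 3 does not divide [k], then [k] is, up to sign, 1, 2 or 4 modulo 9, and
    each of these cases has a pattern of period 9.

    Otherwise let [m] be the largest power of 3 dividing [k]. The hypothesis on
    the gcd says that [3 * m] divides the number of vertices, and [k] is [m] or
    [- m] modulo [3 * m]. Arrange [Z/3m] in 3 rows of length [m], so that the
    [k]-edges join the 3 vertices of a column into a triangle, and the end of
    each row is joined to the start of the next one. There is a total coloring
    for [m = 3] in which all edges from the last column to the first one have
    the same color 4; two columns with triangles colored by 0, 1, 2, joined by
    edges of color 3, can be inserted there as often as needed, which reaches
    every odd [m]. *)

Require Import Defs.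
From HB Require Import structures.
From mathcomp Require Import all_boot zify.

Set Implicit Arguments.
Unset Strict Implicit.
Unset Printing Implicit Defensive.

Lemma uniq_map_inj_in (T1 T2 : eqType) (f : T1 -> T2) (s : seq T1) :
  uniq (map f s) -> {in s &, injective f}.
Proof.
elim: s => //= a s IHs /andP[fa_notin /IHs f_inj] x y.
rewrite !inE => /predU1P[->|xs] /predU1P[->|ys] // fxy; last exact: f_inj.
  by move: fa_notin; rewrite fxy map_f.
by move: fa_notin; rewrite -fxy map_f.
Qed.

(** * Lower bound by the maximum degree *)

(** The edges at [x] have pairwise distinct colors, none of them the color of [x]. *)
Lemma degree_total_colorable (G : sgraph) (q : nat) (x : G) :
  total_colorable G q -> #|[set y | adj x y]| < q.
Proof.
case/existsP=> cv /existsP[ce /and3P[_ /forallP ceP /forallP cevP]].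
have xyE y : adj x y -> [set x; y] \in edges G.
  by move=> xy; apply/imsetP; exists (x, y); rewrite ?inE.
pose g y := oapp ce (cv x) (insub [set x; y] : option (edge G)).
have gE y (xy : adj x y) : g y = ce (Sub [set x; y] (xyE y xy)).
  by rewrite /g (insubT (fun f => f \in edges G) (xyE y xy)).
have g_inj : {in [set y | adj x y] &, injective g}.
  move=> y z; rewrite !inE => xy xz; rewrite !gE => ceq.
  apply/eqP; apply: contraTT isT => yz.
  set f := Sub _ _ in ceq; set f' := Sub _ _ in ceq.
  have /forallP/(_ f')/implyP := ceP f.
  rewrite ceq eqxx; apply; apply/andP; split.
    apply: contraNneq yz => /(congr1 val)/= /setP/(_ y).
    rewrite !inE eqxx orbT => /esym/orP[/eqP yx|//].
    by have := xy; rewrite yx adj_irrefl.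
  by apply/set0Pn; exists x; rewrite !inE eqxx.
have sub : g @: [set y | adj x y] \subset [set~ cv x].
  apply/subsetP=> _ /imsetP[y + ->]; rewrite !inE => xy; rewrite gE.
  have /forallP/(_ x)/implyP := cevP (Sub [set x; y] (xyE y xy)).
  by apply; rewrite !inE eqxx.
move/subset_leq_card: sub; rewrite card_in_imset // cardsC1 card_ord.
by case: q cv {ce ceP cevP g gE g_inj} => [cv|//]; case: (cv x).
Qed.

Lemma max_degree_total_colorable (G : sgraph) (q : nat) (x0 : G) :
  total_colorable G q -> max_degree G < q.
Proof.
have G_gt0 : 0 < #|G| by apply/card_gt0P; exists x0.
have [x] := eq_bigmax (fun x : G => #|[set y | adj x y]|) G_gt0.
by rewrite /max_degree => ->; exact: degree_total_colorable.
Qed.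

(** * Periodic patterns *)

(** A [label] at [x] consists of the colors of [x], of the edge from [x] to
    [x + 1] and of the edge from [x] to [x + k]. In [fits z s t], [s] and [t]
    are the labels at the starting points of the two edges that end at [z]. *)
Notation label := (nat * nat * nat)%type.

Definition fits (z s t : label) : bool :=
  uniq [:: z.1.1; z.1.2; s.1.2; z.2; t.2] && (z.1.1 \notin [:: s.1.1; t.1.1]).

Definition below (q : nat) (z : label) : bool :=
  [&& z.1.1 < q, z.1.2 < q & z.2 < q].

(** Vertices are written [x + k.+1] so that no subtraction occurs. *)
Definition pattern (q n k : nat) (h : nat -> label) : Prop :=
  [/\ forall x y, x = y %[mod n] -> h x = h y,
      forall x, below q (h x) &
      forall x, fits (h (x + k.+1)) (h (x + k)) (h x.+1)].

(** Since [h] has period [N], it cannot tell [k] from [k']. *)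
Lemma pattern_mod q N n k k' h :
  N %| n -> k = k' %[mod N] -> pattern q N k' h -> pattern q n k h.
Proof.
move=> Nn kk' [h_mod h_below h_fits]; split=> // [x y xy|x].
  by apply: h_mod; rewrite -(modn_dvdm x Nn) xy modn_dvdm.
have shift y : y + k = y + k' %[mod N] by apply/eqP; rewrite eqn_modDl kk'.
rewrite -addSnnS (h_mod _ _ (shift x)) (h_mod _ _ (shift x.+1)) addSnnS.
exact: h_fits.
Qed.

(** As [k'] is [- k] modulo [N], the edge between [x] and [x + k] starts at [x + k] in the pattern
    for [k']. *)
Lemma pattern_opp q N k k' h :
  N %| k + k' -> pattern q N k' h ->
  pattern q N k (fun x => ((h x).1, (h (x + k)).2)).
Proof.
move=> Nk [h_mod h_below h_fits]; split=> [x y xy|x|x].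
- by rewrite (h_mod x y) // (h_mod (x + k) (y + k)) // -modnDml xy modnDml.
- by rewrite /below /=; case/and3P: (h_below x) => -> ->;
    case/and3P: (h_below (x + k)) => _ _ ->.
have cancel y : h (y + k + k') = h y.
  by apply: h_mod; rewrite -addnA -modnDmr (eqP Nk) addn0.
have uniq_swap (a b c d e : nat) :
    uniq [:: a; b; c; d; e] = uniq [:: a; b; c; e; d].
  by apply/perm_uniq; rewrite !perm_cons; apply/permPl/(perm_catC [:: d] [:: e]).
(* The first instance describes [x + k + 1], where the last two edges get exchanged; the second one,
   at [x + 1], separates the colors of [x + 1] and [x + k + 1]. *)
have := h_fits (x + k + k); have := h_fits (x + k).
rewrite -!addSnnS !addSn !cancel -!addSn !cancel /fits.
case/andP=> _ adj_x /andP[uniq_z adj_z]; rewrite uniq_swap uniq_z.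
move: adj_x adj_z; rewrite !inE !negb_or /= => /andP[_ xz] /andP[-> _].
by rewrite eq_sym.
Qed.

Definition pattern_of (tab : seq label) (x : nat) : label :=
  nth (0, 0, 0) tab (x %% size tab).

Lemma pattern_ofP q k tab :
  0 < size tab -> all (below q) tab ->
  all (fun x => fits (pattern_of tab (x + k.+1)) (pattern_of tab (x + k))
                     (pattern_of tab x.+1)) (iota 0 (size tab)) ->
  pattern q (size tab) k (pattern_of tab).
Proof.
move=> tab_gt0 /allP tab_below /allP tab_fits.
have tab_mod x y : x = y %[mod size tab] -> pattern_of tab x = pattern_of tab y.
  by rewrite /pattern_of => ->.
split=> // x; first by apply/tab_below/mem_nth; rewrite ltn_pmod.
have := tab_fits (x %% size tab); rewrite mem_iota ltn_pmod // => /(_ isT).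
rewrite !(tab_mod (x %% size tab + _) _ (modnDml _ _ _)).
rewrite -[(x %% _).+1]addn1 -[x.+1]addn1.
by rewrite (tab_mod (x %% size tab + _) _ (modnDml _ _ _)).
Qed.

(** * Patterns of period 9 *)

Definition mk_labels (c e f : seq nat) : seq label := zip (zip c e) f.

(** Modulo 9 the two edges leaving a vertex are parallel. Their pairs of colors
    form a closed nonbacktracking walk of length 9 in the Petersen graph, and a
    vertex gets the color missing from the two pairs around it. *)
Lemma pattern9_1 : exists h, pattern 5 9 1 h.
Proof.
by eexists; apply: (@pattern_ofP 5 1 (mk_labels [:: 0; 2; 1; 0; 2; 4; 0; 2; 3]
  [:: 1; 0; 2; 1; 0; 1; 3; 0; 2] [:: 3; 4; 3; 4; 3; 2; 4; 1; 4])).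
Qed.

Lemma pattern9_2 : exists h, pattern 5 9 2 h.
Proof.
by eexists; apply: (@pattern_ofP 5 2 (mk_labels [:: 0; 2; 1; 0; 3; 1; 0; 4; 1]
  [:: 1; 4; 2; 1; 2; 3; 1; 3; 4] [:: 3; 3; 0; 4; 4; 0; 2; 2; 0])).
Qed.

Lemma pattern9_4 : exists h, pattern 5 9 4 h.
Proof.
by eexists; apply: (@pattern_ofP 5 4 (mk_labels [:: 0; 2; 1; 3; 2; 1; 4; 2; 1]
  [:: 1; 4; 2; 1; 0; 2; 1; 3; 2] [:: 3; 3; 3; 4; 4; 4; 0; 0; 0])).
Qed.

Lemma pattern9 k : ~~ (3 %| k) -> exists h, pattern 5 9 k h.
Proof.
move=> k3.
suff [k' kk' [h hP]] :
    exists2 k', (k == k' %[mod 9]) || (9 %| k + k') &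
                exists h, pattern 5 9 k' h.
  by case/orP: kk' => [/eqP kk'|/pattern_opp opp];
    eexists; [exact: pattern_mod kk' hP | exact: opp hP].
have : k %% 9 \in [:: 1; 2; 4; 5; 7; 8] by rewrite !inE; lia.
rewrite !inE; case/or4P=> [|||/or3P[]] /eqP k9.
- by exists 1; [lia | exact: pattern9_1].
- by exists 2; [lia | exact: pattern9_2].
- by exists 4; [lia | exact: pattern9_4].
- by exists 4; [lia | exact: pattern9_4].
- by exists 2; [lia | exact: pattern9_2].
- by exists 1; [lia | exact: pattern9_1].
Qed.

(** * Patterns of period [3 * m] *)

(** The columns 0, 1, 2 are those of the total coloring for [m = 3]; the columns
    3 and 4 are the ones to be inserted after column 2. *)
Definition strip_rows : seq (seq label) :=
  [:: mk_labels [:: 0; 2; 0; 1; 0] [:: 1; 3; 4; 3; 4] [:: 2; 4; 2; 0; 2];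
      mk_labels [:: 1; 0; 3; 2; 1] [:: 3; 1; 4; 3; 4] [:: 0; 2; 0; 1; 0];
      mk_labels [:: 2; 4; 2; 0; 2] [:: 1; 3; 4; 3; 4] [:: 3; 0; 1; 2; 1]].

Definition strip_label (y s : nat) : label :=
  nth (0, 0, 0) (nth [::] strip_rows (y %% 3)) s.

(** From 3 on the columns alternate between types 3 and 4, so for odd [m > 2] the last one has type
    2 or 4. *)
Definition strip_column (u : nat) : nat := if u < 3 then u else 3 + ~~ odd u.

Definition strip (m x : nat) : label :=
  strip_label (x %/ m) (strip_column (x %% m)).

Lemma stripE m y u :
  u < m -> strip m (y * m + u) = strip_label y (strip_column u).
Proof.
move=> um; have m_gt0 := leq_ltn_trans (leq0n u) um.
by rewrite /strip divnMDl // modnMDl divn_small // modn_small // addn0.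
Qed.

Lemma strip_label_mod y y' s :
  y = y' %[mod 3] -> strip_label y s = strip_label y' s.
Proof. by rewrite /strip_label => ->. Qed.

Lemma strip_below y u : below 5 (strip_label y (strip_column u)).
Proof.
rewrite /strip_label /strip_column; have := ltn_pmod y (isT : 0 < 3).
case: (y %% 3) => [|[|[|//]]] _; case: ifP => [|_]; try by case: (odd u).
all: by case: u => [|[|[|]]].
Qed.

Lemma strip_fits_inside y u :
  fits (strip_label y.+1 (strip_column u.+1)) (strip_label y.+1 (strip_column u))
       (strip_label y (strip_column u.+1)).
Proof.
rewrite /strip_label -addn1 -modnDml; have := ltn_pmod y (isT : 0 < 3).
case: (y %% 3) => [|[|[|//]]] _; rewrite /strip_column.
all: by case: u => [|[|[|u]]] //=; case: (odd u).
Qed.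

(** Here [u] is the last column, of type 2 or 4; in both types the edges to the next row have color
    4. *)
Lemma strip_fits_turn y u :
  1 < u -> ~~ odd u ->
  fits (strip_label y.+2 0) (strip_label y.+1 (strip_column u))
       (strip_label y.+1 0).
Proof.
rewrite /strip_label -[y.+2]addn2 -[y.+1]addn1 -!(modnDml y).
have := ltn_pmod y (isT : 0 < 3).
case: (y %% 3) => [|[|[|//]]] _; rewrite /strip_column.
all: by case: u => [|[|[|u]]] //= _; case: (odd u).
Qed.

Lemma strip_pattern m : 2 < m -> odd m -> pattern 5 (3 * m) m (strip m).
Proof.
move=> m_gt2 m_odd; have m_gt0 : 0 < m by lia.
split=> [x x' xx'|x|x]; last 2 first.
- exact: strip_below.
- rewrite (divn_eq x m); move: (x %/ m) (ltn_pmod x m_gt0) => y.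
  move: (x %% m) => u um.
  have -> : y * m + u + m = y.+1 * m + u by lia.
  have [um1|um1] := ltnP u.+1 m.
    have -> : y * m + u + m.+1 = y.+1 * m + u.+1 by lia.
    by rewrite -addnS !stripE //; exact: strip_fits_inside.
  have -> : y * m + u + m.+1 = y.+2 * m + 0 by lia.
  have -> : (y * m + u).+1 = y.+1 * m + 0 by lia.
  by rewrite !stripE //; apply: strip_fits_turn; lia.
rewrite /strip; have -> : x %% m = x' %% m.
  by rewrite -(modn_dvdm x (dvdn_mull 3 (dvdnn m))) xx' modn_dvdm ?dvdn_mull.
by apply: strip_label_mod; rewrite !modn_divl xx'.
Qed.

(** * From patterns to total colorings of circulant graphs *)

Section Circulant.

Variables (n k : nat).
Hypothesis n_gt0 : 0 < n.

Definition rot_ord (d : nat) (x : 'I_n) : 'I_n :=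
  Ordinal (ltn_pmod (x + d) n_gt0).

Lemma eq_rot_ord d (x y : 'I_n) : (y == rot_ord d x) = (x + d == y %[mod n]).
Proof. by rewrite -val_eqE /= eq_sym [y %% n]modn_small. Qed.

(** [(x, true)] stands for the edge from [x] to [x + 1] and [(x, false)] for the
    edge from [x] to [x + k]. *)
Definition tip (d : 'I_n * bool) : 'I_n := rot_ord (if d.2 then 1 else k) d.1.

Lemma circulant_adj_tip (x y : circulant n [:: 1; k]) :
  adj x y -> exists d, [set x; y] = [set d.1; tip d] /\
                       (d.1 = x /\ tip d = y \/ d.1 = y /\ tip d = x).
Proof.
case/andP=> _ /= ; rewrite orbF -!orbA !(eq_sym (x %% n)) -!eq_rot_ord.
case/or4P=> /eqP->.
- by exists (y, true); rewrite setUC; split; last right.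
- by exists (x, true); split; last left.
- by exists (y, false); rewrite setUC; split; last right.
- by exists (x, false); split; last left.
Qed.

Section Coloring.

Variables (q : nat) (h : nat -> label).
Hypothesis h_pattern : pattern q n k h.

Definition dart_color (d : 'I_n * bool) : nat :=
  if d.2 then (h d.1).1.2 else (h d.1).2.

(** This localizes the conditions of a total coloring at [z]; [s] consists of the two darts leaving
    [z] and the two ending there. *)
Lemma pattern_star (z : 'I_n) :
  exists s : seq ('I_n * bool),
    [/\ forall d, z \in [set d.1; tip d] -> d \in s,
        uniq ((h z).1.1 :: map dart_color s) &
        forall d, tip d = z -> (h d.1).1.1 != (h z).1.1].
Proof.
have [h_mod _ h_fits] := h_pattern.
(* This is [z - (k + 1)] modulo [n]. *)
pose x := z + n.-1 * k.+1.
have xz : x + k.+1 = z %[mod n].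
  have -> : x + k.+1 = k.+1 * n + z.
    by rewrite /x -addnA -mulSnr prednK // mulnC addnC.
  by rewrite modnMDl.
pose a := Ordinal (ltn_pmod (x + k) n_gt0).
pose b := Ordinal (ltn_pmod x.+1 n_gt0).
have ha : h a = h (x + k) by apply: h_mod; rewrite modn_mod.
have hb : h b = h x.+1 by apply: h_mod; rewrite modn_mod.
have tipP d : tip d = z -> d.1 = if d.2 then a else b.
  move/(congr1 val) => /=; rewrite -[RHS](modn_small (ltn_ord z)) -xz.
  case: d => y [] /= yz; apply/val_inj/eqP;
    rewrite -[X in X == _](modn_small (ltn_ord y)) /=.
    by rewrite -(eqn_modDr 1) yz -[x + k + 1]addnA addn1.
  by rewrite -(eqn_modDr k) yz addSnnS.
have := h_fits x; rewrite (h_mod _ _ xz) -ha -hb /fits => /andP[z_uniq z_adj].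
exists [:: (z, true); (a, true); (z, false); (b, false)]; split=> // [d|d].
  rewrite !inE => /orP[/eqP->|/eqP/esym/tipP].
    by case: d => x' [] /=; rewrite eqxx ?orbT.
  by case: d => x' [] /= ->; rewrite eqxx ?orbT.
move: z_adj; rewrite !inE negb_or !(eq_sym (h z).1.1) => /andP[za zb] /tipP ->.
by case: d.2.
Qed.

Lemma circulant_colorable : total_colorable (circulant n [:: 1; k]) q.
Proof.
have [_ h_below _] := h_pattern; set G := circulant n [:: 1; k].
have color_lt d : dart_color d < q.
  by rewrite /dart_color; case: ifP; case/and3P: (h_below d.1).
have vcolor_lt (x : G) : (h x).1.1 < q by case/and3P: (h_below x).
have dartP (f : edge G) : exists d, val f == [set d.1; tip d].
  case: f => f /= /imsetP[[x y]]; rewrite inE /= => xy ->.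
  by have [d [-> _]] := circulant_adj_tip xy; exists d.
(* Any dart representing [f] will do, since all darts at a vertex have distinct colors. *)
pose dart f := xchoose (dartP f).
have dartE f : val f = [set (dart f).1; tip (dart f)] :=
  eqP (xchooseP (dartP f)).
apply/existsP; exists [ffun x => Ordinal (vcolor_lt x)].
apply/existsP; exists [ffun f => Ordinal (color_lt (dart f))].
apply/and3P; split; apply/forallP=> a; apply/forallP=> b; apply/implyP;
  rewrite !ffunE.
- rewrite -val_eqE => /circulant_adj_tip[d [_ [] [<- dtip]]]; last rewrite eq_sym.
    by have [s [_ _]] := pattern_star (tip d); rewrite dtip; apply.
  by have [s [_ _]] := pattern_star (tip d); rewrite dtip; apply.
- case/andP=> ab /set0Pn[z]; rewrite inE !dartE => /andP[za zb].
  have [s [sP /= /andP[_ /uniq_map_inj_in s_inj] _]] := pattern_star z.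
  apply: contra_neq ab => /(congr1 val) color_ab.
  have dart_ab := s_inj _ _ (sP _ za) (sP _ zb) color_ab.
  by apply/val_inj; rewrite !dartE dart_ab.
- rewrite dartE -val_eqE => ba; have [s [sP /= /andP[+ _] _]] := pattern_star b.
  by apply: contraNneq => <-; rewrite map_f ?sP.
Qed.

End Coloring.

Lemma circulant_max_degree :
  1 < k -> k.*2 < n -> max_degree (circulant n [:: 1; k]) = 4.
Proof.
move=> k_gt1 k2n; set G := circulant n [:: 1; k].
have deg (x : G) : #|[set y | adj x y]| = 4.
  (* Here [n - d] stands for [- d]; the shifts are distinct because [1 < k < n - k < n - 1]. *)
  pose s := [seq rot_ord d x | d <- [:: 1; k; n - 1; n - k]].
  have -> : [set y | adj x y] = [set y in s].
    apply/setP=> y; rewrite !inE circulant_adjE /=; last by lia.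
    have opp d : d < n -> (y == rot_ord (n - d) x) = (x == y + d %[mod n]).
      move=> dn; rewrite eq_rot_ord -(eqn_modDr d) -addnA subnK ?modnDr //.
      exact: ltnW.
    have [n1 kn] : 1 < n /\ k < n by lia.
    rewrite (opp 1 n1) (opp k kn) !eq_rot_ord orbF.
    by do 4 case: (_ == _).
  rewrite cardsE; apply/card_uniqP.
  rewrite map_inj_in_uniq => [|d d' d_in d'_in /(congr1 val) /= /eqP].
    by rewrite /= !inE; lia.
  have dn e : e \in [:: 1; k; n - 1; n - k] -> e < n by rewrite !inE; lia.
  by rewrite eqn_modDl !modn_small ?dn // => /eqP.
apply/eqP; rewrite eqn_leq; apply/andP; split.
  by apply/bigmax_leqP=> x _; rewrite deg.
by rewrite -(deg (Ordinal n_gt0)); apply: leq_bigmax.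
Qed.

End Circulant.

Theorem theorem2p3 (p k : nat) (p_ge1 : 1 <= p)
    (k_range : 2 <= k <= (9 * p - 1) %/ 2)
    (k_gcd : exists s : nat, 1 <= s /\ 9 * p %/ gcdn (9 * p) k = 3 * s) :
  type_I (circulant (9 * p) [:: 1; k]) /\
  total_chromatic_number (circulant (9 * p) [:: 1; k]) = 5.
Proof.
have n_gt0 : 0 < 9 * p by lia.
have maxdeg : max_degree (circulant (9 * p) [:: 1; k]) = 4.
  by apply: circulant_max_degree => //; lia.
suff chi5 : total_chromatic_number (circulant (9 * p) [:: 1; k]) = 5.
  by rewrite /type_I maxdeg.
have k_gt0 : 0 < k by lia.
have [h hP] : exists h, pattern 5 (9 * p) k h.
  have [k3|k3] := boolP (3 %| k); last first.
    have [h hP] := pattern9 k3.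
    by exists h; apply: pattern_mod hP; rewrite ?dvdn_mulr.
  have [t t3 kE] := pfactor_coprime (isT : prime 3) k_gt0.
  set m := 3 ^ logn 3 k in kE.
  (* If 3 divided [9 * p] no more often than [k], the quotient by the gcd would be prime to 3. *)
  have m3n : 3 * m %| 9 * p.
    case: k_gcd => s [s_gt0 nE].
    have g_gt0 : 0 < gcdn (9 * p) k by rewrite gcdn_gt0 n_gt0.
    rewrite -expnS pfactor_dvdn //.
    have /(congr1 (logn 3)) : 9 * p = 3 * s * gcdn (9 * p) k.
      by rewrite -nE divnK ?dvdn_gcdl.
    rewrite [in RHS]lognM ?muln_gt0 // [in RHS]lognM // logn_gcd //.
    rewrite (logn_prime 3 (isT : prime 3)) eqxx; lia.
  have m_gt2 : 2 < m.
    have : 0 < logn 3 k by rewrite logn_gt0 mem_primes k_gt0.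
    rewrite /m; case: (logn 3 k) => // l _.
    by rewrite expnS; have := expn_gt0 3 l; lia.
  have m_odd : odd m by rewrite oddX orbT.
  have mP := strip_pattern m_gt2 m_odd.
  have [t_mod|t_mod] : t %% 3 = 1 \/ t %% 3 = 2.
  - by move: t3; rewrite prime_coprime //; lia.
  - eexists; apply: (pattern_mod m3n _ mP).
    have -> : k = t %/ 3 * (3 * m) + m
      by rewrite kE {1}(divn_eq t 3) t_mod; lia.
    by rewrite modnMDl.
  eexists; apply: (pattern_mod m3n (erefl _)); apply: pattern_opp mP.
  have -> : k + m = (t %/ 3).+1 * (3 * m)
      by rewrite kE {1}(divn_eq t 3) t_mod; lia.
  exact: dvdn_mull.
rewrite /total_chromatic_number; case: ex_minnP => c c_col c_min.
apply/eqP; rewrite eqn_leq c_min ?(circulant_colorable n_gt0 hP) //=.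
rewrite -maxdeg; apply: max_degree_total_colorable c_col.
exact: Ordinal n_gt0.
Qed.
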